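(* For all $n\ge 4$, $\mathrm{r}_n(1342)=2\,\mathrm{r}_{n-1}(1342)+\mathrm{r}_{n-2}(1342)+2$.
   Context: $\mathcal{S}_n$ is the set of permutations of $[n]$, $\pi^r$ the reversal of $\pi$. A word $w$ contains $\rho\in\mathcal{S}_k$ if some subsequence $w_{i_1}\cdots w_{i_k}$ ($i_1<\cdots<i_k$) satisfies $w_{i_a}\le w_{i_b}$ iff $\rho_a\le\rho_b$; otherwise it avoids $\rho$. $\mathcal{R}_n=\{\pi\pi^r:\pi\in\mathcal{S}_n\}$ (concatenation of $\pi$ with its reversal), and $\mathrm{r}_n(\rho)$ is the number of members of $\mathcal{R}_n$ avoiding $\rho$. *)

(* Defs.v *)
From mathcomp Require Import all_boot all_fingroup.

Set Implicit Arguments.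
Unset Strict Implicit.
Unset Printing Implicit Defensive.

(* The alphabet [n] is represented by 'I_n, i.e. every letter (and every
   position) is shifted down by one; only the order of the letters matters. *)

Definition one_line (n : nat) (p : 'S_n) : n.-tuple 'I_n := [tuple p i | i < n].

Definition contains (m n k : nat) (w : m.-tuple 'I_n) (rho : 'S_k) : bool :=
  [exists i : {ffun 'I_k -> 'I_m},
    [forall a : 'I_k, forall b : 'I_k, (a < b) ==> (i a < i b)] &&
    [forall a : 'I_k, forall b : 'I_k,
      (tnth w (i a) <= tnth w (i b)) == (rho a <= rho b)]].

Definition avoids (m n k : nat) (w : m.-tuple 'I_n) (rho : 'S_k) : bool :=
  ~~ contains w rho.

Definition rcp (n : nat) : {set (n + n).-tuple 'I_n} :=
  [set [tuple of one_line p ++ rev (one_line p)] | p : 'S_n].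

Definition r (k n : nat) (rho : 'S_k) : nat := #|[set w in rcp n | avoids w rho]|.

Definition word1342 : 4.-tuple 'I_4 :=
  [tuple @Ordinal 4 0 isT; @Ordinal 4 2 isT; @Ordinal 4 3 isT; @Ordinal 4 1 isT].

Lemma word1342_inj : injective (tnth word1342).
Proof. by apply/tuple_uniqP. Qed.

Definition p1342 : 'S_4 := perm word1342_inj.

Lemma one_line_p1342 : one_line p1342 = word1342.
Proof. by apply: eq_from_tnth => i; rewrite tnth_mktuple permE. Qed.

(* Main.v *)
(* Remove the first letter x of p: it is both the first and the last letter of
   p p^r, so p p^r avoids 1342 iff the inner palindrome does and in addition has
   no 231 above x and no "a b c" with a < x < b < c.  Any two letters of p occur
   in both orders in p p^r, which makes these conditions very restrictive.  For
   n >= 4, with the letters 0, ..., n-1: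
   - x = n-1 and x = n-2 impose nothing, giving r_(n-1) each;
   - x = n-3 forces the second letter n-2 and nothing more, giving r_(n-2);
   - x = 0 forces the rest to be decreasing up to the order of its last two
     letters, giving 2;
   - no other x is possible. *)

Require Import Defs.
From mathcomp Require Import all_boot all_fingroup.
From mathcomp Require Import zify.

Set Implicit Arguments.
Unset Strict Implicit.
Unset Printing Implicit Defensive.

(** * Occurrences of 1342 as subsequences of words over the naturals *)

Definition avoids1342 (w : seq nat) : bool :=
  [forall m : (size w).-tuple bool,
    if mask m w is [:: a; b; c; d] then ~~ [&& a < d, d < b & b < c] else true].

Lemma avoids1342P (w : seq nat) :
  reflect (forall a b c d, subseq [:: a; b; c; d] w -> a < d -> d < b -> b < c -> False)
          (avoids1342 w).
Proof.
apply: (iffP forallP) => [avw a b c d /subseqP [m sz_m def_m] ad db bc | avw m].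
  have szP : size m == size w by apply/eqP.
  by have := avw (Tuple szP); rewrite /= -def_m ad db bc.
case def_t: (mask m w) => [|a [|b [|c [|d []]]]] //.
apply/negP => /and3P []; apply: avw.
by rewrite -def_t mask_subseq.
Qed.

(** Translates between occurrences given by increasing positions, as in [contains], and occurrences
    given as subsequences. *)
Lemma subseq_nth (T : eqType) (x0 : T) (t s : seq T) :
  subseq t s <->
  exists js, [/\ sorted ltn js, all (gtn (size s)) js & t = map (nth x0 s) js].
Proof.
split=> [/subseqP [m _ ->] | [js [js_sorted /allP js_lt ->]]].
  exists (mask m (iota 0 (size s))); split.
  - by rewrite sorted_mask ?iota_ltn_sorted //; apply: ltn_trans.
  - by apply/allP => j /mem_mask; rewrite mem_iota.
  by rewrite map_mask -/(mkseq _ _) mkseq_nth.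
(* An increasing list is determined by its members, so [js] is a filtered interval. *)
have -> : js = filter (mem js) (iota 0 (size s)).
  apply: (irr_sorted_eq ltn_trans ltnn) => //.
    by rewrite sorted_filter ?iota_ltn_sorted //; apply: ltn_trans.
  move=> j; rewrite mem_filter mem_iota /=.
  by case jjs: (j \in js) => //=; move: (js_lt _ jjs) => /= ->.
by rewrite -[X in subseq _ X](mkseq_nth x0) map_subseq ?filter_subseq.
Qed.

Lemma subseq_rcons2 (T : eqType) (t w : seq T) (d x : T) :
  subseq (rcons t d) (rcons w x) =
  if d == x then subseq t w else subseq (rcons t d) w.
Proof.
rewrite -subseq_rev !rev_rcons /=; case: ifP => _; first by rewrite subseq_rev.
by rewrite -rev_rcons subseq_rev.
Qed.

(** Agreeing with the pattern on all pairs of positions amounts to the chain a < d < b < c between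
    the four letters. *)
Lemma avoidsE (m n : nat) (w : m.-tuple 'I_n) :
  avoids w p1342 = avoids1342 (map val w).
Proof.
apply/idP/idP => [av | /avoids1342P av].
  apply/avoids1342P => a b c d; rewrite (subseq_nth 0) size_map size_tuple.
  case=> js [js_sorted js_lt].
  case: js js_sorted js_lt => [|j1 [|j2 [|j3 [|j4 []]]]] //=.
  case/and4P=> j12 j23 j34 _ /and5P [l1 l2 l3 l4 _] [-> -> -> ->] ad db bc.
  case/negP: av; apply/existsP.
  pose js := [tuple Ordinal l1; Ordinal l2; Ordinal l3; Ordinal l4].
  exists [ffun k => tnth js k].
  have wE (j : 'I_m) : tnth w j = nth 0 (map val w) j :> nat.
    by rewrite -(tnth_nth 0 [tuple of map val w]) tnth_map.
  apply/andP; split; apply/forallP => -[[|[|[|[|//]]]] p]; apply/forallP => -[[|[|[|[|//]]]] q];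
    rewrite !ffunE ?permE ?wE !(tnth_nth (Ordinal l1)) ?(tnth_nth ord0) /=; lia.
apply/negP => /existsP [i /andP [/forallP mono /forallP pat]].
have mn (a b : 'I_4) : a < b -> i a < i b by move/implyP: (forallP (mono a) b); apply.
have pt a b := eqP (forallP (pat a) b).
pose o k (h : k < 4) : 'I_4 := Ordinal h.
have wE (j : 'I_m) : tnth w j = nth 0 (map val w) j :> nat.
  by rewrite -(tnth_nth 0 [tuple of map val w]) tnth_map.
pose v j := nth 0 (map val w) j.
apply: (av (v (i (@o 0 isT))) (v (i (@o 1 isT))) (v (i (@o 2 isT))) (v (i (@o 3 isT)))).
- apply/(subseq_nth 0).
  exists [:: val (i (@o 0 isT)); val (i (@o 1 isT)); val (i (@o 2 isT)); val (i (@o 3 isT))].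
  by split=> //=; rewrite ?mn //= size_map size_tuple !ltn_ord.
(* Each pair is compared with the larger pattern letter first: the failure of [<=] then gives the
   strict inequality. *)
- by have := pt (@o 3 isT) (@o 0 isT); rewrite !wE !permE !(tnth_nth ord0) /= -/(v _) -/(v _); lia.
- by have := pt (@o 1 isT) (@o 3 isT); rewrite !wE !permE !(tnth_nth ord0) /= -/(v _) -/(v _); lia.
by have := pt (@o 2 isT) (@o 1 isT); rewrite !wE !permE !(tnth_nth ord0) /= -/(v _) -/(v _); lia.
Qed.

(** * Palindromes, and counting them through lists of letters *)

Definition pal (T : Type) (s : seq T) := s ++ rev s.

Definition pal_avoids1342 (s : seq nat) := avoids1342 (pal s).

(** The list [s] is arbitrary because deleting a first letter leaves a set of letters with a gap. *)
Definition avoiding_perms (s : seq nat) := [seq t <- permutations s | pal_avoids1342 t].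

Lemma mem_avoiding_perms s t : (t \in avoiding_perms s) = pal_avoids1342 t && perm_eq t s.
Proof. by rewrite mem_filter mem_permutations. Qed.

Lemma avoiding_perms_uniq s : uniq (avoiding_perms s).
Proof. by rewrite filter_uniq ?permutations_uniq. Qed.

Lemma r1342E n : r n p1342 = size (avoiding_perms (iota 0 n)).
Proof.
pose W (p : 'S_n) : (n + n).-tuple 'I_n := [tuple of one_line p ++ rev (one_line p)].
pose L (p : 'S_n) : seq nat := map val (one_line p).
have L_inj : injective L.
  move=> p q /(inj_map val_inj) /val_inj eq_pq; apply/permP => i.
  by have := congr1 (@tnth _ _ ^~ i) eq_pq; rewrite !tnth_mktuple.
have W_inj : injective W.
  move=> p q /(congr1 val) /= /eqP; rewrite eqseq_cat ?size_tuple // => /andP [/eqP e _].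
  by apply: L_inj; rewrite /L /= e.
have WE p : avoids (W p) p1342 = pal_avoids1342 (L p).
  by rewrite avoidsE /pal_avoids1342 /pal /= map_cat map_rev.
have -> : r n p1342 = #|[set p : 'S_n | pal_avoids1342 (L p)]|.
  rewrite /r -(card_imset _ W_inj); apply: eq_card => w; rewrite !inE.
  apply/andP/imsetP => [[/imsetP [p _ ->]] | [p]].
    by exists p => //; rewrite inE -WE.
  by rewrite inE -WE => ? ->; split=> //; apply/imsetP; exists p.
have L_uniq : uniq (map L (enum 'S_n)) by rewrite map_inj_uniq ?enum_uniq.
have L_perm p : perm_eq (L p) (iota 0 n).
  have L_un : uniq (L p).
    rewrite map_inj_uniq; last exact: val_inj.
    by rewrite map_inj_uniq ?enum_uniq //; apply: perm_inj.
  have sub : {subset L p <= iota 0 n}.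
    by move=> _ /mapP [i _ ->]; rewrite mem_iota /=.
  have [|_ L_mem] := uniq_min_size L_un sub; first by rewrite size_iota size_map size_tuple.
  by rewrite uniq_perm ?iota_uniq.
have sub : {subset map L (enum 'S_n) <= permutations (iota 0 n)}.
  by move=> _ /mapP [p _ ->]; rewrite mem_permutations.
(* The n! distinct lists of values lie among the n! permutations of [iota 0 n], hence exhaust
   them. *)
have [|_ L_mem] := uniq_min_size L_uniq sub.
  by rewrite size_map -cardE card_Sn size_permutations ?iota_uniq // size_iota.
have /perm_size <- :
    perm_eq [seq t <- map L (enum 'S_n) | pal_avoids1342 t] (avoiding_perms (iota 0 n)).
  by rewrite uniq_perm ?filter_uniq ?permutations_uniq // => t; rewrite !mem_filter L_mem.
rewrite filter_map size_map cardE; congr size.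
by rewrite /enum_mem -filter_predI; apply: eq_filter => p; rewrite !inE andbT.
Qed.

(** * Adding a first letter to a palindrome *)

Lemma pal_cons (T : Type) (x : T) (s : seq T) : pal (x :: s) = x :: rcons (pal s) x.
Proof. by rewrite /pal rev_cons /= -rcons_cat. Qed.

Lemma mem_pal (T : eqType) (s : seq T) : pal s =i s.
Proof. by move=> x; rewrite mem_cat mem_rev orbb. Qed.

(** Take x from [s] and y from its reversal. *)
Lemma pal2 (T : eqType) (s : seq T) (x y : T) :
  x \in s -> y \in s -> subseq [:: x; y] (pal s).
Proof.
move=> xs ys; rewrite -[[:: x; y]]/([:: x] ++ [:: y]).
by rewrite cat_subseq // sub1seq ?mem_rev.
Qed.

(** An occurrence that uses the initial x has it as its 1, leaving a 231 above x; one that uses the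
    final x has it as its 2, leaving a 134 around x. It cannot use both, as the 1 and the 2
    differ. *)
Lemma pal_avoids1342_cons x s :
  pal_avoids1342 (x :: s) <->
  [/\ pal_avoids1342 s,
      forall b c d, subseq [:: b; c; d] (pal s) -> x < d -> d < b -> b < c -> False
    & forall a b c, subseq [:: a; b; c] (pal s) -> a < x -> x < b -> b < c -> False].
Proof.
rewrite /pal_avoids1342 pal_cons; split.
  move/avoids1342P=> av; split.
  - apply/avoids1342P => a b c d sub; apply: av.
    by apply: (subseq_trans sub); apply: (subseq_trans (subseq_rcons _ _)); apply: subseq_cons.
  - move=> b c d sub; apply: (av x); rewrite /= eqxx.
    by apply: (subseq_trans sub); apply: subseq_rcons.
  move=> a b c sub ax xb bc; apply: (av a b c x) => //.
  apply: subseq_trans (subseq_cons _ _).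
  by rewrite -[[:: a; b; c; x]]/(rcons [:: a; b; c] x) subseq_rcons2 eqxx.
case=> /avoids1342P av0 av1 av2; apply/avoids1342P => a b c d.
rewrite /=; case: eqP => [-> | _].
  rewrite -[[:: b; c; d]]/(rcons [:: b; c] d) subseq_rcons2; case: eqP => [->|_]; first lia.
  exact: av1.
rewrite -[[:: a; b; c; d]]/(rcons [:: a; b; c] d) subseq_rcons2; case: eqP => [->|_].
  by move=> sub ax xb; apply: (av2 _ _ _ sub).
exact: av0.
Qed.

(** Both obstructions need two distinct letters above x. *)
Lemma pal_avoids1342_cons_top x s :
  pal_avoids1342 s -> (forall b c, b \in s -> c \in s -> x < b -> x < c -> b = c) ->
  pal_avoids1342 (x :: s).
Proof.
move=> gs top; apply/pal_avoids1342_cons; split=> // [b c d | a b c] /mem_subseq sub.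
  have bs : b \in s by rewrite -mem_pal sub ?inE ?eqxx.
  have ds : d \in s by rewrite -mem_pal sub ?inE ?eqxx ?orbT.
  by move=> xd db; have := top b d bs ds; lia.
have bs : b \in s by rewrite -mem_pal sub ?inE ?eqxx ?orbT.
have cs : c \in s by rewrite -mem_pal sub ?inE ?eqxx ?orbT.
by move=> ax xb bc; have := top b c bs cs; lia.
Qed.

(** At most two letters exceed x, namely y and one larger letter, so there is no 231 above x. In a <
    x < b < c the letter b must be y, but y stands only at the two ends of the inner palindrome. *)
Lemma pal_avoids1342_cons_second x y s :
  pal_avoids1342 (y :: s) -> y \notin s -> x < y ->
  (forall b c, b \in s -> c \in s -> x < b -> x < c -> b = c) ->
  (forall b, b \in s -> x < b -> y < b) -> pal_avoids1342 (x :: y :: s).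
Proof.
move=> gs ys xy top ymin; apply/pal_avoids1342_cons; split=> // [b c d | a b c] sub_pal.
  have mem e : e \in [:: b; c; d] -> e = y \/ e \in s.
    by move/(mem_subseq sub_pal); rewrite mem_pal inE => /orP [/eqP|]; [left | right].
  have [] := (mem b, mem c, mem d); rewrite !inE !eqxx ?orbT.
  move=> [/(_ isT) hb /(_ isT) hc] /(_ isT) hd xd db bc.
  case: hb => [eb|hb]; case: hc => [ec|hc]; case: hd => [ed|hd]; try lia.
  - by have := top c d hc hd; lia.
  - by have := top b d hb hd; lia.
  - by have := top b c hb hc; lia.
  by have := top b c hb hc; lia.
move=> ax xb bc.
have mem e : e \in [:: a; b; c] -> e = y \/ e \in s.
  by move/(mem_subseq sub_pal); rewrite mem_pal inE => /orP [/eqP|]; [left | right].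
have [] := (mem b, mem c); rewrite !inE !eqxx ?orbT => /(_ isT) hb /(_ isT) hc.
have cs : c \in s by case: hc => // ec; case: hb => [|/ymin]; lia.
have eb : b = y by case: hb => // bs; have := top b c bs cs; lia.
move: sub_pal; rewrite pal_cons /=; case: eqP => [|_]; first lia.
rewrite -[[:: a; b; c]]/(rcons [:: a; b] c) subseq_rcons2; case: eqP => [|_]; first lia.
move/mem_subseq/(_ b); rewrite mem_pal !inE eqxx orbT eb => /(_ isT).
by rewrite (negPf ys).
Qed.

(** The second letter f occurs before and after any two letters of the remaining list, so each wrong
    choice of f or x yields an obstruction. *)
Lemma pal_avoids1342_cons_middle x s n :
  perm_eq (x :: s) (iota 0 n.+4) -> pal_avoids1342 (x :: s) -> 0 < x -> x < n.+2 ->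
  x = n.+1 /\ exists s', s = n.+2 :: s'.
Proof.
case: s => [|f s]; first by move/perm_size; rewrite size_iota.
move=> ps /pal_avoids1342_cons [_ av231 av123] x0 xn.
have mem k : k < n.+4 -> k <> x -> k <> f -> k \in s.
  move=> kn /eqP kx /eqP kf; have := perm_mem ps k.
  by rewrite !inE mem_iota (negPf kx) (negPf kf) /= => ->; lia.
have xf : x <> f by have := perm_uniq ps; rewrite iota_uniq /= inE => /andP [/norP [/eqP]].
have sub_l y z : y \in s -> z \in s -> subseq [:: f; y; z] (pal (f :: s)).
  move=> ys zs; rewrite pal_cons /= eqxx.
  exact: subseq_trans (pal2 ys zs) (subseq_rcons _ _).
have sub_r y z : y \in s -> z \in s -> subseq [:: y; z; f] (pal (f :: s)).
  move=> ys zs; rewrite pal_cons; apply: subseq_trans (subseq_cons _ _).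
  by rewrite -[[:: y; z; f]]/(rcons [:: y; z] f) subseq_rcons2 eqxx pal2.
(* If f < x, then f followed by the two largest letters is forbidden. *)
have [fx | fx] := ltnP f x.
  by case: (av123 f n.+2 n.+3); rewrite ?sub_l ?mem //; lia.
(* If f > x + 1, the word 0, x + 1, f is forbidden; here 0 < x is used. *)
have fE : f = x.+1.
  apply/eqP; apply/negPn/negP => /eqP fNx.
  by case: (av123 0 x.+1 f); rewrite ?sub_r ?mem //; lia.
(* If x is smaller, the two largest letters followed by f = x + 1 form a 231 above x. *)
have xE : x = n.+1.
  apply/eqP; apply/negPn/negP => /eqP xNn.
  by case: (av231 n.+2 n.+3 f); rewrite ?sub_r ?mem //; lia.
by split=> //; exists s; rewrite fE xE.
Qed.

(** * Palindromes that also avoid 231, as required after a smallest first letter *)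

Definition pal_avoids231 (s : seq nat) : Prop :=
  forall b c d, subseq [:: b; c; d] (pal s) -> d < b -> b < c -> False.

(** A maximal end letter can be neither the 2 nor the 1 of a 231, both being below the 3. *)
Lemma pal_avoids231_cons_max y s :
  (forall z, z \in s -> z < y) -> (pal_avoids231 (y :: s) <-> pal_avoids231 s).
Proof.
move=> ymax; rewrite /pal_avoids231 pal_cons; split=> av b c d sub db bc.
  apply: (av b c d) => //; apply: (subseq_trans sub).
  by apply: (subseq_trans (subseq_rcons _ _)); apply: subseq_cons.
have le_y e : e \in [:: b; c; d] -> e <= y.
  move/(mem_subseq sub); rewrite inE mem_rcons inE mem_pal orbA orbb.
  by case/orP => [/eqP -> | /ymax /ltnW].
have cy : c <= y by rewrite le_y ?inE ?eqxx ?orbT.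
move: sub; rewrite /=; case: eqP => [|_]; first lia.
rewrite -[[:: b; c; d]]/(rcons [:: b; c] d) subseq_rcons2; case: eqP => [|_]; first lia.
by move/av; apply.
Qed.

(** The word k + m + 1, ..., k + 2 followed by [u], which is to arrange the two smallest letters k
    and k + 1. *)
Definition decreasing_to (k m : nat) (u : seq nat) : seq nat := rev (iota k.+2 m) ++ u.

(** By induction on m: while at least three letters remain, the largest must come first; the last
    two are free. *)
Lemma pal_avoids1342_avoids231E k m s : perm_eq s (iota k m.+2) ->
  (pal_avoids1342 s /\ pal_avoids231 s <->
   s \in [:: decreasing_to k m [:: k; k.+1]; decreasing_to k m [:: k.+1; k]]).
Proof.
elim: m s => [|m IHm] s ps.
  split=> [_|].
    move: ps; case: s => [|a [|b [|c s]]]; try by move/perm_size.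
    move=> ps; have := perm_mem ps a; have := perm_mem ps b.
    rewrite /= !inE !eqxx ?orbT /decreasing_to /= !eqseq_cons !eqxx.
    by have := perm_uniq ps; rewrite /= !inE; lia.
  move=> _; split.
    have mem := perm_mem ps; have := perm_size ps.
    case: s ps mem => [|a [|b [|c s]]] //= ps mem _.
    apply: pal_avoids1342_cons_top; last by move=> p q; rewrite !inE; lia.
    by apply: pal_avoids1342_cons_top => //; apply/avoids1342P.
  move=> b c d /mem_subseq sub db bc.
  have mem e : e \in [:: b; c; d] -> (e == k) || (e == k.+1).
    by move/sub; rewrite mem_pal (perm_mem ps) !inE.
  have [] := (mem b, mem c, mem d); rewrite !inE !eqxx ?orbT.
  by move=> [/(_ isT) hb /(_ isT) hc] /(_ isT); lia.
case: s ps => [|y s] ps; first by move/perm_size: ps.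
have dE u : decreasing_to k m.+1 u = (k + m.+2) :: decreasing_to k m u.
  by rewrite /decreasing_to -[m.+1]addn1 iotaD rev_cat /= !addSn !addnS addn0.
have s_lt z : y = k + m.+2 -> z \in s -> z < y.
  move=> yE zs; have := perm_mem ps z; rewrite inE zs orbT mem_iota.
  have := perm_uniq ps; rewrite iota_uniq /= => /andP [ys _].
  have : z != y by apply: contra ys => /eqP <-.
  lia.
have ps' : y = k + m.+2 -> perm_eq s (iota k m.+2).
  move=> yE; rewrite -(perm_cons y); apply: (perm_trans ps).
  by rewrite -[m.+3]addn1 iotaD perm_catC /= yE.
rewrite !dE; split=> [[gs av] | ].
  have yE : y = k + m.+2.
    apply/eqP; apply/negPn/negP => /eqP yN.
    have mem e : k <= e < k + m.+3 -> e <> y -> e \in s.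
      by move=> ek /eqP ey; have := perm_mem ps e; rewrite inE (negPf ey) mem_iota => /= ->.
    have cs : k + m.+2 \in s by apply: mem => //; lia.
    (* With three letters or more, some e differs from both y and the maximum. As y stands at both
       ends, either y, maximum, e or e, maximum, y is a 231. *)
    have [e es [ey e_lt]] : exists2 e, e \in s & e <> y /\ e < k + m.+2.
      by have [yk|/eqP yk] := eqVneq y k; [exists k.+1 | exists k];
        try apply: mem; rewrite ?yk; lia.
    have y_lt : y < k + m.+2 by have := perm_mem ps y; rewrite inE eqxx mem_iota; lia.
    have [ltey | leye] := ltnP e y.
      apply: (av y (k + m.+2) e) => //; rewrite pal_cons /= eqxx.
      exact: subseq_trans (pal2 cs es) (subseq_rcons _ _).
    apply: (av e (k + m.+2) y); try lia.
    rewrite pal_cons; apply: subseq_trans (subseq_cons _ _).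
    by rewrite -[[:: e; _; y]]/(rcons [:: e; _] y) subseq_rcons2 eqxx pal2.
  have [gs' _ _] := (pal_avoids1342_cons y s).1 gs.
  have /(IHm _ (ps' yE)) : pal_avoids1342 s /\ pal_avoids231 s.
    by split=> //; apply/(pal_avoids231_cons_max (s_lt^~ yE)).
  by rewrite !inE !eqseq_cons yE eqxx.
rewrite !inE !eqseq_cons -andb_orr => /andP [/eqP yE hs].
have [|gs av] := (IHm _ (ps' yE)).2; first by rewrite !inE.
split; last by apply/pal_avoids231_cons_max => // z; apply: s_lt.
by apply: pal_avoids1342_cons_top => // b c bs _ yb; have := s_lt b yE bs; lia.
Qed.

(** * Order-preserving relabelling of letters *)

Lemma avoids1342_map h w : {mono h : x y / x < y} -> avoids1342 (map h w) = avoids1342 w.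
Proof.
move=> h_mono; apply/avoids1342P/avoids1342P => av a b c d.
  move=> sub ad db bc; apply: (av (h a) (h b) (h c) (h d)); rewrite ?h_mono //.
  exact: (map_subseq h sub).
case/subseqP => m _; rewrite -map_mask.
case def_t: (mask m w) => [|a' [|b' [|c' [|d' []]]]] //= [-> -> -> ->].
by rewrite !h_mono; apply: av; rewrite -def_t mask_subseq.
Qed.

Lemma pal_avoids1342_map h s :
  {mono h : x y / x < y} -> pal_avoids1342 (map h s) = pal_avoids1342 s.
Proof. by move=> h_mono; rewrite /pal_avoids1342 /pal -map_rev -map_cat avoids1342_map. Qed.

(** Relabelling letterwise is a bijection between the two lists; this closes the gaps left by
    deleted letters. *)
Lemma size_avoiding_perms_map h s :
  {mono h : x y / x < y} -> size (avoiding_perms (map h s)) = size (avoiding_perms s).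
Proof.
move=> h_mono; rewrite -(size_map (map h) (avoiding_perms s)); apply: perm_size.
have h_inj : injective h.
  by move=> x y hxy; have := h_mono x y; have := h_mono y x; rewrite hxy ltnn; lia.
apply: uniq_perm; rewrite ?map_inj_uniq ?avoiding_perms_uniq //; first exact: inj_map.
move=> t; rewrite mem_avoiding_perms; apply/andP/mapP => [[gt] | [t']].
  (* Write t through a permutation [js] of the indices; the same indices read in [s] give its
     preimage. *)
  case/(perm_iotaP (h 0)) => js js_perm def_t.
  have tE : t = map h (map (nth 0 s) js).
    rewrite def_t -map_comp; apply/eq_in_map => j; rewrite (perm_mem js_perm) mem_iota size_map.
    by move=> /= j_lt; rewrite (nth_map 0).
  exists (map (nth 0 s) js) => //; rewrite mem_avoiding_perms.
  rewrite -(pal_avoids1342_map _ h_mono) -tE gt /=.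
  by apply/(perm_iotaP 0); exists js; rewrite // -(size_map h s).
by rewrite mem_avoiding_perms => /andP [gt' pt'] ->; rewrite pal_avoids1342_map // perm_map.
Qed.

Lemma bump_mono v : {mono bump v : x y / x < y}.
Proof. by move=> x y; rewrite /bump; lia. Qed.

(** [bump v] enumerates in increasing order the naturals other than v. *)
Lemma perm_bump_iota v n :
  v <= n -> perm_eq (v :: map (bump v) (iota 0 n)) (iota 0 n.+1).
Proof.
move=> vn; apply: uniq_perm; rewrite ?iota_uniq //=.
  rewrite map_inj_uniq ?iota_uniq ?andbT; last exact: can_inj (bumpK v).
  by apply/mapP => -[j _ /eqP]; rewrite (negPf (neq_bump v j)).
move=> j; rewrite inE -[0 :: iota 1 n]/(iota 0 n.+1) mem_iota /=.
apply/orP/idP => [[/eqP ->|/mapP [i]] | jn]; rewrite ?mem_iota //.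
  by rewrite /bump => + ->; lia.
have [->|jv] := eqVneq j v; [by left | right].
by apply/mapP; exists (unbump v j); rewrite ?mem_iota /bump /unbump; lia.
Qed.

Lemma perm_cons_iota v s n : v <= n ->
  perm_eq (v :: s) (iota 0 n.+1) = perm_eq s (map (bump v) (iota 0 n)).
Proof. by move=> vn; rewrite -(permPr (perm_bump_iota vn)) perm_cons. Qed.

(** * The recurrence, by classifying the first letter *)

Theorem theorem14 (n : nat) (hn : 4 <= n) :
  r n p1342 = 2 * r (n - 1) p1342 + r (n - 2) p1342 + 2.
Proof.
have [m ->] : exists m, n = m.+4 by exists (n - 4); lia.
rewrite !r1342E subSS subn0 !subSS subn0 {n hn}.
(* Letters left after deleting x ([A x]) or both m + 1 and m + 2 ([B]); [C] holds the two words that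
   may follow 0. *)
pose A x := map (bump x) (iota 0 m.+3).
pose B := map (bump m.+1) (map (bump m.+1) (iota 0 m.+2)).
pose C := [:: decreasing_to 1 m.+1 [:: 1; 2]; decreasing_to 1 m.+1 [:: 2; 1]].
have A_perm x s : x <= m.+3 -> perm_eq (x :: s) (iota 0 m.+4) = perm_eq s (A x).
  exact: perm_cons_iota.
have B_perm s : perm_eq [:: m.+1, m.+2 & s] (iota 0 m.+4) = perm_eq s B.
  rewrite A_perm; last lia.
  (* [bump m.+1] sends m + 1 to m + 2, so deleting m + 2 from [A m.+1] is deleting m + 1 before
     relabelling. *)
  have A_B : perm_eq (m.+2 :: B) (A m.+1).
    have := perm_bump_iota (ltnW (leqnn m.+2)) => /(perm_map (bump m.+1)) /=.
    by rewrite {1}/bump leqnn.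
  by rewrite -(permPr A_B) perm_cons.
(* No letter is below 0 and all others are above it, so just plain 231-avoidance is added. *)
have C_good s : perm_eq (0 :: s) (iota 0 m.+4) -> pal_avoids1342 (0 :: s) = (s \in C).
  rewrite -[iota 0 _]/(0 :: iota 1 m.+3) perm_cons => ps.
  have gE := pal_avoids1342_avoids231E ps.
  apply/idP/idP => [/pal_avoids1342_cons [gs av _] | /gE [gs av]].
    apply/gE; split=> // b c d sub db bc; apply: (av b c d sub) => //.
    have : d \in s by rewrite -mem_pal (mem_subseq sub) ?inE ?eqxx ?orbT.
    by rewrite (perm_mem ps) mem_iota; lia.
  by apply/pal_avoids1342_cons; split=> // b c d sub _; apply: av.
have C_perm s : s \in C -> perm_eq s (iota 1 m.+3).
  have rev_perm u : perm_eq u [:: 1; 2] -> perm_eq (rev (iota 3 m.+1) ++ u) (iota 1 m.+3).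
    move=> pu; rewrite -[m.+3]add2n iotaD perm_sym perm_catC.
    by rewrite perm_cat ?(perm_sym _ u) // perm_sym perm_rev.
  by rewrite !inE => /orP [] /eqP ->; apply: rev_perm.
pose lists :=
  map (cons m.+3) (avoiding_perms (A m.+3)) ++
  map (cons m.+2) (avoiding_perms (A m.+2)) ++
  map (fun s => [:: m.+1, m.+2 & s]) (avoiding_perms B) ++ map (cons 0) C.
have lists_perm : perm_eq (avoiding_perms (iota 0 m.+4)) lists.
  apply: uniq_perm; first exact: avoiding_perms_uniq.
    have C_uniq : uniq C by rewrite /= inE andbT eqseq_cat // eqxx.
    have cons_inj x : injective (cons x : seq nat -> seq nat) by move=> ? ? [].
    have cons2_inj x y : injective (fun s : seq nat => [:: x, y & s]) by move=> ? ? [].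
    rewrite !cat_uniq !(map_inj_uniq (@cons_inj _)) (map_inj_uniq (@cons2_inj _ _)).
    rewrite !avoiding_perms_uniq C_uniq !andTb andbT.
    (* The four families are disjoint because their first letters differ. *)
    apply/and3P; split; apply/hasPn => t; rewrite ?mem_cat => ht; apply/mapP => -[s _ tE];
      move: ht; rewrite {}tE.
    - case/or3P => /mapP [? _ []]; lia.
    - case/orP => /mapP [? _ []]; lia.
    by case/mapP.
  have in_range x s e : perm_eq (x :: s) (iota 0 m.+4) -> e \in s -> e < m.+4 /\ e <> x.
    move=> ps es; have := perm_mem ps e; rewrite inE es orbT mem_iota => e_lt; split; first lia.
    by move=> ex; have := perm_uniq ps; rewrite iota_uniq /= -ex es.
  move=> t; rewrite mem_avoiding_perms !mem_cat; apply/andP/or4P.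
    case: t => [|x s] [gs ps]; first by move/perm_size: ps.
    have [gs' _ _] := (pal_avoids1342_cons x s).1 gs.
    have x_lt : x < m.+4 by have := perm_mem ps x; rewrite inE eqxx mem_iota; lia.
    have [x3|/eqP x3] := eqVneq x m.+3.
      by move: ps; rewrite x3 A_perm // => ps; apply: Or41; rewrite map_f // mem_avoiding_perms gs'.
    have [x2|/eqP x2] := eqVneq x m.+2.
      by move: ps; rewrite x2 A_perm // => ps; apply: Or42; rewrite map_f // mem_avoiding_perms gs'.
    have [x0|/eqP x0] := eqVneq x 0.
      by apply: Or44; move: gs ps; rewrite x0 => gs ps; rewrite map_f // -C_good.
    have [|| x1 [s' sE]] := pal_avoids1342_cons_middle ps gs; [lia | lia |].
    apply: Or43; apply/mapP; exists s'; last by rewrite x1 sE.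
    by move: gs' ps; rewrite sE x1 B_perm mem_avoiding_perms => /pal_avoids1342_cons [-> _ _].
  case=> /mapP [s].
  - rewrite mem_avoiding_perms => /andP [gs]; rewrite -A_perm // => ps ->; split=> //.
    by apply: pal_avoids1342_cons_top => // b c /(in_range _ _ _ ps); lia.
  - rewrite mem_avoiding_perms => /andP [gs]; rewrite -A_perm // => ps ->; split=> //.
    by apply: pal_avoids1342_cons_top => // b c /(in_range _ _ _ ps) ? /(in_range _ _ _ ps); lia.
  (* The only letter of [s] above m + 1 is m + 3, so m + 2 can be prepended first and then m + 1. *)
  - rewrite mem_avoiding_perms => /andP [gs]; rewrite -B_perm // => ps ->; split=> //.
    have in_s e : e \in s -> [/\ e < m.+4, e <> m.+1 & e <> m.+2].
      move=> es; have [|e_lt e1] := in_range _ _ e ps; first by rewrite inE es orbT.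
      split=> // e2; have := perm_uniq ps; rewrite iota_uniq /= -e2 es !andbF //.
    apply: pal_avoids1342_cons_second => //.
    + apply: pal_avoids1342_cons_top => // b c /in_s [? ? ?] /in_s [? ? ?]; lia.
    + by apply/negP => /in_s [].
    + by move=> b c /in_s [? ? ?] /in_s [? ? ?]; lia.
    by move=> b /in_s [? ? ?]; lia.
  move=> sC ->.
  have ps : perm_eq (0 :: s) (iota 0 m.+4) by rewrite perm_cons C_perm.
  by rewrite C_good.
rewrite (perm_size lists_perm) !size_cat !size_map !size_avoiding_perms_map; try exact: bump_mono.
by rewrite /=; lia.
Qed.
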